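(* Suppose that $\mathcal C$ is a class of countable models (of a sentence in a countable language, closed under isomorphism) such that every $K\in\mathcal C$ has an elementary extension in $\mathcal C$ realizing a type which is not realized in $K$, and suppose $\mathcal C$ is closed under unions of countable elementary chains. Then $\mathcal C$ is not essentially countable, i.e. the isomorphism relation on the space of models in $\mathcal C$ with domain $\omega$ is not Borel bireducible with any countable Borel equivalence relation. *)

(* Defs.v *)
From HB Require Import structures.
From mathcomp Require Import all_boot all_order all_algebra.
From mathcomp Require Import all_classical all_reals all_analysis.
Set Implicit Arguments.
Unset Strict Implicit.
Unset Printing Implicit Defensive.
Local Open Scope classical_set_scope.

(* The language is countable because its sets of symbols are countTypes;
   constants are the function symbols of arity 0. *)
Record language := Language {
  funsym : countType;
  farity : funsym -> nat;
  relsym : countType;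
  rarity : relsym -> nat
}.

Record structure (L : language) := Structure {
  carrier :> Type;
  fint : forall f : funsym L, ('I_(farity f) -> carrier) -> carrier;
  rint : forall r : relsym L, ('I_(rarity r) -> carrier) -> bool
}.

Arguments fint {L} s f _.
Arguments rint {L} s r _.

(* [term L n] and [formula L n] are the terms and the L_{omega_1,omega}-formulas
   whose free variables are among x_0, ..., x_(n-1).  In [FEx], the bound
   variable is x_0 and the free variables are shifted by one. *)
Inductive term (L : language) (n : nat) : Type :=
| TVar of 'I_n
| TApp (f : funsym L) of ('I_(farity f) -> term L n).

Inductive formula (L : language) : nat -> Type :=
| FEq n of term L n & term L n : formula L n
| FRel n (r : relsym L) of ('I_(rarity r) -> term L n) : formula L n
| FNot n of formula L n : formula L n
| FAnd n of formula L n & formula L n : formula L n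
| FBigAnd n of (nat -> formula L n) : formula L n
| FEx n of formula L n.+1 : formula L n.

Definition sentence (L : language) := formula L 0.

Fixpoint first_order (L : language) (n : nat) (phi : formula L n) : Prop :=
  match phi with
  | FEq _ _ _ | FRel _ _ _ => True
  | FNot _ psi => first_order psi
  | FAnd _ psi1 psi2 => first_order psi1 /\ first_order psi2
  | FBigAnd _ _ => False
  | FEx _ psi => first_order psi
  end.

Definition env_cons (A : Type) (n : nat) (x : A) (a : 'I_n -> A) :
    'I_n.+1 -> A :=
  fun i => if unlift ord0 i is Some j then a j else x.

Fixpoint teval (L : language) (K : structure L) (n : nat) (a : 'I_n -> K)
    (t : term L n) : K :=
  match t with
  | TVar i => a i
  | TApp f ts => fint K f (fun i => teval a (ts i))
  end.

Fixpoint sat (L : language) (K : structure L) (n : nat) (phi : formula L n) :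
    ('I_n -> K) -> Prop :=
  match phi in formula _ m return ('I_m -> K) -> Prop with
  | FEq _ t u => fun a => teval a t = teval a u
  | FRel _ r ts => fun a => rint K r (fun i => teval a (ts i))
  | FNot _ psi => fun a => ~ sat psi a
  | FAnd _ psi1 psi2 => fun a => sat psi1 a /\ sat psi2 a
  | FBigAnd _ psi => fun a => forall k, sat (psi k) a
  | FEx _ psi => fun a => exists x : K, sat psi (env_cons x a)
  end.

Definition models (L : language) (K : structure L) (sigma : sentence L) : Prop :=
  forall a : 'I_0 -> K, sat sigma a.

Definition countable_model (L : language) (sigma : sentence L)
    (K : structure L) : Prop :=
  [/\ inhabited K, countable [set: K] & models K sigma].

Definition embedding (L : language) (K M : structure L) (h : K -> M) : Prop :=
  [/\ injective h,
      forall f a, h (fint K f a) = fint M f (h \o a) &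
      forall r a, rint K r a = rint M r (h \o a)].

Definition isomorphic (L : language) (K M : structure L) : Prop :=
  exists h : K -> M, embedding h /\ bijective h.

Definition elementary (L : language) (K M : structure L) (h : K -> M) : Prop :=
  forall (n : nat) (phi : formula L n), first_order phi ->
  forall a : 'I_n -> K, sat phi a <-> sat phi (h \o a).

Definition realizes (L : language) (K : structure L) (n : nat)
    (p : set (formula L n)) : Prop :=
  exists a : 'I_n -> K, forall phi, p phi -> sat phi a.

(* [p] ranges over the first-order n-types without parameters, given as sets of
   first-order formulas; consistency follows from being realized in [M]. *)
Definition realizes_new_type (L : language) (K M : structure L) : Prop :=
  exists (n : nat) (p : set (formula L n)),
    [/\ p `<=` @first_order L n, realizes M p & ~ realizes K p].

(* [M] is, up to isomorphism, the union of the chain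
   K 0 -> K 1 -> K 2 -> ... with transition maps [e]. *)
Definition is_chain_union (L : language) (K : nat -> structure L)
    (e : forall n, K n -> K n.+1) (M : structure L) : Prop :=
  exists j : forall n, K n -> M,
    [/\ forall n, embedding (j n),
        forall n x, j n.+1 (e n x) = j n x &
        forall y : M, exists n, exists x : K n, y = j n x].

Definition closed_under_isomorphism (L : language) (C : structure L -> Prop) :
    Prop :=
  forall K M, C K -> isomorphic K M -> C M.

Definition closed_under_elementary_chains (L : language)
    (C : structure L -> Prop) : Prop :=
  forall (K : nat -> structure L) (e : forall n, K n -> K n.+1)
    (M : structure L),
  (forall n, C (K n)) -> (forall n, elementary (e n)) ->
  is_chain_union e M -> C M.

(* nat and bool carry the discrete topology. *)
Definition model_space (L : language) : topologicalType :=
  (prod_topology (fun f : funsym L =>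
     prod_topology (fun _ : 'I_(farity f) -> nat => nat)) *
   prod_topology (fun r : relsym L =>
     prod_topology (fun _ : 'I_(rarity r) -> nat => bool)))%type.

Definition structure_of (L : language) (x : model_space L) : structure L :=
  @Structure L nat (fun f a => x.1 f a) (fun r a => x.2 r a).

Definition space_of (L : language) (C : structure L -> Prop) :
    set (model_space L) :=
  [set x | C (structure_of x)].

Definition iso_on (L : language) (C : structure L -> Prop)
    (x y : space_of C) : Prop :=
  isomorphic (structure_of (\val x)) (structure_of (\val y)).

Definition borel (T : topologicalType) : set (set T) := <<s @open T >>.

Definition borel_map (T U : topologicalType) (f : T -> U) : Prop :=
  forall B, borel B -> borel (f @^-1` B).

Definition borel_reducible (T U : topologicalType)
    (E : T -> T -> Prop) (F : U -> U -> Prop) : Prop :=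
  exists f : T -> U, borel_map f /\ forall x y, E x y <-> F (f x) (f y).

Definition borel_bireducible (T U : topologicalType)
    (E : T -> T -> Prop) (F : U -> U -> Prop) : Prop :=
  borel_reducible E F /\ borel_reducible F E.

Definition separable_space (T : topologicalType) : Prop :=
  exists2 D : set T, countable D & dense D.

(* A Hausdorff pseudometric space is a metric space. *)
Definition polish (R : realType) (Y : completePseudoMetricType R) : Prop :=
  hausdorff_space Y /\ separable_space Y.

Definition countable_borel_equivalence (T : topologicalType)
    (E : T -> T -> Prop) : Prop :=
  [/\ RelationClasses.Equivalence E,
      borel ([set p | E p.1 p.2] : set (T * T)%type) &
      forall x, countable [set y | E x y]].

Definition essentially_countable (R : realType) (T : topologicalType)
    (E : T -> T -> Prop) : Prop :=
  exists (Y : completePseudoMetricType R) (F : Y -> Y -> Prop),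
    [/\ polish Y, countable_borel_equivalence F & borel_bireducible E F].

(* Main.v *)
Require Import Defs.
From HB Require Import structures.
From mathcomp Require Import all_boot all_order all_algebra.
From mathcomp Require Import all_classical all_reals all_analysis.
From mathcomp Require Import lra.
Set Implicit Arguments.
Unset Strict Implicit.
Unset Printing Implicit Defensive.
Import Order.TTheory GRing.Theory Num.Theory.
Local Open Scope classical_set_scope.

(** Suppose f is a Borel reduction of isomorphism to F, all of whose classes
    are countable.  Force with pairs (x, p), where x is a model in C with
    universe nat, extended elementarily within C, and p is a finite injective
    sequence, an initial segment of a generic enumeration of x.  Closure under
    chains yields models x over which every relevant Borel statement about the
    enumerated copy of x is decided densely by the sequences p alone.
    For such x the values of f on the copies of x lie in a single, countable,
    F-class, so some p forces f to take a fixed value y: otherwise a generic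
    copy of x would avoid all members of the class.  Forcing persists to
    elementary extensions in C, hence p still forces the value y over a generic
    extension x2 of x that realizes a type omitted in x.  Then x and x2 have
    copies with the same image under f, so they are isomorphic, which is
    absurd.  This replaces the usual chain of length omega_1 and the Vaught
    transforms by chains of length omega. *)

(** * Elementary maps *)

Lemma env_cons0 (A : Type) (n : nat) (x : A) (a : 'I_n -> A) :
  env_cons x a ord0 = x.
Proof. by rewrite /env_cons unlift_none. Qed.

Lemma env_cons_lift (A : Type) (n : nat) (x : A) (a : 'I_n -> A) i :
  env_cons x a (lift ord0 i) = a i.
Proof. by rewrite /env_cons liftK. Qed.

Lemma comp_env_cons (A B : Type) (h : A -> B) (n : nat) (x : A)
    (a : 'I_n -> A) :
  h \o env_cons x a = env_cons (h x) (h \o a).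
Proof. by apply/funext => i; rewrite /env_cons /=; case: unlift. Qed.

Section Elementary.
Variable L : language.
Implicit Types K M N : structure L.

Lemma teval_embedding K M (h : K -> M) n (a : 'I_n -> K) (t : term L n) :
  embedding h -> teval (h \o a) t = h (teval a t).
Proof.
move=> [_ hf _]; elim: t => [i|f ts IH] //=.
by rewrite hf; congr (fint M f _); apply/funext => i /=.
Qed.

Lemma sat_iso K M (h : K -> M) n (phi : formula L n) (a : 'I_n -> K) :
  embedding h -> bijective h -> sat phi a <-> sat phi (h \o a).
Proof.
move=> he [h' hK h'K]; have [hi _ hr] := he.
elim: phi a => {n} [n t u|n r ts|n phi IH|n p1 IH1 p2 IH2|n ps IH|n phi IH] a /=.
- rewrite !teval_embedding //; split=> [->//|]; exact: hi.
- rewrite hr; suff -> : h \o (fun i => teval a (ts i)) =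
    (fun i => teval (h \o a) (ts i)) by [].
  by apply/funext => i /=; rewrite teval_embedding.
- by rewrite IH.
- by rewrite IH1 IH2.
- by split=> H k; apply/IH; exact: H.
- split=> [[x]|[y]].
    by move=> /IH; rewrite comp_env_cons; exists (h x).
  by rewrite -(h'K y) -comp_env_cons => /IH; exists (h' y).
Qed.

Lemma elementary_iso K M (h : K -> M) :
  embedding h -> bijective h -> elementary h.
Proof. by move=> he hb n phi _ a; apply: sat_iso. Qed.

Lemma elementary_comp K M N (h : K -> M) (k : M -> N) :
  elementary h -> elementary k -> elementary (k \o h).
Proof.
move=> hel kel n phi fo a; rewrite (hel _ _ fo) (kel _ _ fo).
by rewrite compA.
Qed.

Lemma elementary_id K : elementary (@id K).
Proof. by []. Qed.

(** Each clause is elementarity for one atomic formula: [x_0 = x_1] read from [M] back to [K],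
    [x_0 = f(x_1, ...)], and [r(x_0, ...)]. *)
Lemma elementary_embedding K M (h : K -> M) : elementary h -> embedding h.
Proof.
move=> hel; split.
- move=> x y hxy.
  have := hel 2 (FEq (TVar L ord0) (TVar L (lift ord0 ord0))) I
    (env_cons x (env_cons y (fun _ => x))).
  rewrite /= !env_cons_lift !env_cons0 => -[_]; exact.
- move=> f a.
  have := hel _ (FEq (TVar L ord0) (TApp (fun i => TVar L (lift ord0 i)))) I
    (env_cons (fint K f a) a).
  rewrite comp_env_cons /= !env_cons0.
  have E (N : structure L) x (b : 'I_(farity f) -> N) :
      (fun i => env_cons x b (lift ord0 i)) = b.
    by apply/funext => i; rewrite env_cons_lift.
  by rewrite !E => -[+ _]; apply.
- move=> r a.
  have /= H := hel _ (FRel (fun i => TVar L i)) I a.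
  by apply/idP/idP => /H.
Qed.

Lemma isomorphic_trans K M N :
  isomorphic K M -> isomorphic M N -> isomorphic K N.
Proof.
move=> [h [[hi hf hr] hb]] [k [[ki kf kr] kb]]; exists (k \o h); split.
  by split=> [|f a|r a]; [exact: inj_comp|rewrite /= hf kf|rewrite hr kr].
exact: bij_comp.
Qed.

Lemma isomorphic_sym K M : isomorphic K M -> isomorphic M K.
Proof.
move=> [h [[hi hf hr] [k hK kK]]]; exists k.
have E m (a : 'I_m -> M) : h \o (k \o a) = a by apply/funext => i /=.
split; last by exists h.
split=> [|f a|r a]; first exact: can_inj kK.
- by apply: hi; rewrite kK hf E.
- by rewrite hr E.
Qed.

Lemma realizes_elementary K M (h : K -> M) n (p : set (formula L n)) :
  p `<=` @first_order L n -> elementary h -> realizes K p -> realizes M p.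
Proof.
move=> pfo hel [a Ha]; exists (h \o a) => phi pphi.
by apply/hel; [exact: pfo|exact: Ha].
Qed.

(** If [a] lists the finite structure [K], the first-order formula [FEx psi], stating that some
    element differs from every [a i], fails in [K]; a point of [M] outside the range of [h] would
    make it true in [M]. *)
Lemma elementary_finite_surj K M (h : K -> M) :
  elementary h -> finite_set [set: K] -> forall y, exists x, h x = y.
Proof.
move=> hel [n] /card_bijP [/= f [g fK gK]] y.
pose a (i : 'I_n) : K := \val (g (exist _ (i : nat) (mem_set (ltn_ord i)))).
have aS x : exists i, a i = x.
  pose s : [set: K] := exist _ x (mem_set I).
  have lt : (\val (f s) < n)%N by have := set_valP (f s).
  exists (Ordinal lt); rewrite /a /=.
  suff -> : exist _ (\val (f s)) (mem_set (ltn_ord (Ordinal lt))) = f s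
    by rewrite fK.
  exact: val_inj.
pose psi := foldr (fun i => FAnd (FNot (FEq (TVar L ord0) (TVar L (lift ord0 i)))))
  (FEq (TVar L ord0) (TVar L ord0)) (enum 'I_n).
have fopsi : first_order (FEx psi).
  by rewrite /psi /=; elim: (enum 'I_n).
have satpsi N (b : 'I_n -> N) z :
    sat psi (env_cons z b) <-> forall i, z <> b i.
  have -> : (forall i, z <> b i) <-> (forall i, i \in enum 'I_n -> z <> b i).
    by split=> H i => [_|]; apply: H; rewrite ?mem_enum.
  rewrite /psi; elim: (enum 'I_n) => [|i s IH] //=.
  rewrite env_cons0 env_cons_lift IH; split.
    by move=> [ne H] j; rewrite in_cons => /orP[/eqP ->|/H].
  move=> H; split; first by apply: H; exact: mem_head.
  by move=> j js; apply: H; rewrite in_cons js orbT.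
apply: contrapT => ny.
have [_] := hel _ _ fopsi a; case.
  by exists y; apply/satpsi => i E; apply: ny; exists (a i).
by move=> x /satpsi H; have [i E] := aS x; apply: (H i).
Qed.

End Elementary.

(** * Unions of elementary chains *)

(** Composites of the transition maps. The existential form avoids casts between the types [K m] for
    equal indices; compatibility with [j] is all that is used to identify the map. *)
Lemma chain_map (L : language) (K : nat -> structure L)
    (e : forall n, K n -> K n.+1) (U : Type) (j : forall n, K n -> U) :
  (forall n, elementary (e n)) ->
  (forall n x, j n.+1 (e n x) = j n x) ->
  forall n m, (n <= m)%N ->
  exists h : K n -> K m, elementary h /\ forall x, j m (h x) = j n x.
Proof.
move=> eel jS n; elim=> [|m IH].
  by rewrite leqn0 => /eqP ->; exists id; split; first exact: elementary_id.
rewrite leq_eqVlt => /orP[/eqP ->|].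
  by exists id; split; first exact: elementary_id.
rewrite ltnS => /IH [h [hel hj]]; exists (e m \o h); split.
  exact: elementary_comp hel (eel m).
by move=> x /=; rewrite jS hj.
Qed.

Lemma chain_common_level (I : finType) (A : nat -> Type) (U : Type)
    (j : forall n, A n -> U) :
  (forall n m, (n <= m)%N -> forall x : A n, exists y : A m, j m y = j n x) ->
  forall u : I -> U, (forall i, exists n (x : A n), u i = j n x) ->
  exists n (b : I -> A n), u = @j n \o b.
Proof.
move=> up u /choice [n] H; exists (\max_i n i).
suff /choice [b Hb] : forall i, exists y : A (\max_i n i), j _ y = u i.
  by exists b; apply/funext => i /=; rewrite Hb.
move=> i; have [x ->] := H i.
exact/up/leq_bigmax.
Qed.

(** Tarski's elementary chain theorem. Only the quantifier needs an argument: a witness in [M] comes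
    from some level [m], the induction hypothesis applies at level [maxn n m], and elementarity of
    the chain pulls the formula back to level [n]. *)
Lemma elementary_chain_union (L : language) (K : nat -> structure L)
    (e : forall n, K n -> K n.+1) (M : structure L) (j : forall n, K n -> M) :
  (forall n, elementary (e n)) ->
  (forall n, embedding (j n)) ->
  (forall n x, j n.+1 (e n x) = j n x) ->
  (forall y : M, exists n, exists x : K n, y = j n x) ->
  forall n, elementary (j n).
Proof.
move=> eel jemb jS jsurj n k phi.
elim: phi n => {k} [k t u|k r ts|k phi IH|k p1 IH1 p2 IH2|k ps IH|k phi IH] n /=.
- move=> _ a; rewrite !teval_embedding //; split=> [->//|].
  by have [ji _ _] := jemb n; exact: ji.
- move=> _ a; have [_ _ jr] := jemb n; rewrite jr.
  suff -> : j n \o (fun i => teval a (ts i)) =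
    (fun i => teval (j n \o a) (ts i)) by [].
  by apply/funext => i /=; rewrite teval_embedding.
- by move=> fo a; rewrite (IH n).
- by move=> [fo1 fo2] a; rewrite (IH1 n) // (IH2 n).
- by [].
- move=> fo a; split=> [[x]|[y]].
    by move=> /(IH n fo); rewrite comp_env_cons; exists (j n x).
  have [m [x ->]] := jsurj y.
  have [h [hel hj]] := chain_map eel jS (leq_maxl n m).
  have [h' [h'el h'j]] := chain_map eel jS (leq_maxr n m).
  rewrite -h'j; have -> : j n \o a = j (maxn n m) \o (h \o a).
    by apply/funext => i /=; rewrite hj.
  rewrite -comp_env_cons => /IH - /(_ fo) H.
  by apply/(hel k (FEx phi) fo a); exists (h' x).
Qed.

(** * Direct limits of elementary chains of models with universe [nat] *)

Section ChainLimit.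
Variables (L : language) (x : nat -> model_space L) (e : nat -> nat -> nat).
Let K n := structure_of (x n).
Hypothesis eel : forall n, elementary (e n : K n -> K n.+1).

Let e_inj n : injective (e n).
Proof. by have [] := elementary_embedding (@eel n). Qed.

(* An element of the union is named by the least level at which it appears,
   together with its value there. *)
Fixpoint chain_name (n k : nat) : nat * nat :=
  if n is m.+1 then
    if pselect (exists i, e m i = k) is left H then chain_name m (sval (cid H))
    else (n, k)
  else (0%N, k).

Lemma chain_nameS n k : chain_name n.+1 (e n k) = chain_name n k.
Proof.
rewrite /=; case: pselect => [H|[]]; last by exists k.
by case: cid => i /= /e_inj ->.
Qed.

Lemma chain_name_le n k : ((chain_name n k).1 <= n)%N.
Proof.
elim: n k => [|n IH] k //=; case: pselect => [H|//].
exact: leq_trans (IH _) _.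
Qed.

(** An element new at level [n.+1] has first coordinate [n.+1], which by [chain_name_le] occurs in
    no name inherited from level [n]. *)
Lemma chain_name_inj n : injective (chain_name n).
Proof.
elim: n => [|n IH] k k' /=; first by case.
case: pselect => H; case: pselect => H'.
- by case: cid => i /= <-; case: cid => i' /= <- /IH ->.
- move=> E; have := chain_name_le n (sval (cid H)).
  by rewrite E ltnn.
- move=> E; have := chain_name_le n (sval (cid H')).
  by rewrite -E ltnn.
- by case.
Qed.

Definition limit_carrier := {p : nat * nat | exists n k, chain_name n k = p}.

Definition limit_inj n (k : K n) : limit_carrier :=
  exist _ (chain_name n k) (ex_intro _ n (ex_intro _ k erefl)).

Lemma limit_injS n k : @limit_inj n.+1 (e n k) = @limit_inj n k.
Proof. exact/eq_exist/chain_nameS. Qed.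

Lemma limit_inj_inj n : injective (@limit_inj n).
Proof. by move=> k k' /(congr1 sval) /chain_name_inj. Qed.

Lemma limit_inj_surj (u : limit_carrier) : exists n (k : K n), u = limit_inj k.
Proof. by case: u => p Hp; case: (Hp) => n [k E]; exists n, k; exact: eq_exist. Qed.

Lemma limit_tuple r (a : 'I_r -> limit_carrier) :
  exists n (b : 'I_r -> K n), a = @limit_inj n \o b.
Proof.
apply: chain_common_level => [n m le_nm k|i]; last exact: limit_inj_surj.
by have [h [_ H]] := chain_map eel limit_injS le_nm; exists (h k).
Qed.

Lemma limit_tuple_map r n m (b : 'I_r -> K n) (c : 'I_r -> K m) :
  (n <= m)%N -> @limit_inj n \o b = @limit_inj m \o c ->
  exists h : K n -> K m,
    [/\ elementary h, forall k, limit_inj (h k) = limit_inj k & c = h \o b].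
Proof.
move=> /(chain_map eel limit_injS) [h [hel H]] E; exists h; split=> //.
apply/funext => i; apply: limit_inj_inj; rewrite /= H.
by have := congr1 (@^~ i) E.
Qed.

Definition limit_level r (a : 'I_r -> limit_carrier) := cid (limit_tuple a).

Definition limit_coord r (a : 'I_r -> limit_carrier) :=
  cid (projT2 (limit_level a)).

(** Symbols are evaluated at an arbitrarily chosen level containing the arguments;
    [limit_inj_embedding] shows that the choice does not matter. *)
Definition limit_structure : structure L :=
  @Structure L limit_carrier
    (fun f a => limit_inj (fint (K (projT1 (limit_level a))) f
                            (projT1 (limit_coord a))))
    (fun r a => rint (K (projT1 (limit_level a))) r (projT1 (limit_coord a))).

Lemma limit_inj_embedding n : embedding (@limit_inj n : K n -> limit_structure).
Proof.
split; first exact: limit_inj_inj.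
- move=> f a.
  suff H m (b : 'I_(farity f) -> K m) : @limit_inj n \o a = @limit_inj m \o b ->
      limit_inj (fint (K n) f a) = limit_inj (fint (K m) f b).
    exact: (H _ _ (projT2 (limit_coord (@limit_inj n \o a)))).
  move=> E; have [nm|/ltnW mn] := leqP n m.
    have [h [/elementary_embedding [_ hf _] hj ->]] := limit_tuple_map nm E.
    by rewrite -hf hj.
  have [h [/elementary_embedding [_ hf _] hj ->]] :=
    limit_tuple_map mn (esym E).
  by rewrite -hf hj.
- move=> r a.
  suff H m (b : 'I_(rarity r) -> K m) : @limit_inj n \o a = @limit_inj m \o b ->
      rint (K n) r a = rint (K m) r b.
    exact: (H _ _ (projT2 (limit_coord (@limit_inj n \o a)))).
  move=> E; have [nm|/ltnW mn] := leqP n m.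
    by have [h [/elementary_embedding [_ _ hr] hj ->]] := limit_tuple_map nm E.
  by have [h [/elementary_embedding [_ _ hr] hj ->]] :=
    limit_tuple_map mn (esym E).
Qed.

End ChainLimit.

Lemma chain_union_exists (L : language) (x : nat -> model_space L)
    (e : forall n, structure_of (x n) -> structure_of (x n.+1)) :
  (forall n, elementary (e n)) ->
  exists (M : structure L) (j : forall n, structure_of (x n) -> M),
    [/\ forall n, embedding (j n),
        forall n k, j n.+1 (e n k) = j n k &
        forall y, exists n (k : structure_of (x n)), y = j n k].
Proof.
move=> eel; exists (limit_structure eel), (@limit_inj L x e); split.
- exact: limit_inj_embedding.
- exact: limit_injS.
- exact: limit_inj_surj.
Qed.

(** * Models with universe nat *)

Definition enum_model (L : language) (K : structure L) (g : nat -> K)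
    (g' : K -> nat) : model_space L :=
  (fun f a => g' (fint K f (g \o a)), fun r a => rint K r (g \o a)).

Lemma enum_model_iso (L : language) (K : structure L) (g : nat -> K)
    (g' : K -> nat) :
  cancel g g' -> cancel g' g -> isomorphic (structure_of (enum_model g g')) K.
Proof.
move=> gK g'K; exists g; split; last by exists g'.
by split=> [|f a|r a]; [exact: can_inj gK|exact: g'K|].
Qed.

Lemma countable_infinite_enum (T : Type) :
  countable [set: T] -> ~ finite_set [set: T] ->
  exists (g : nat -> T) (g' : T -> nat), cancel g g' /\ cancel g' g.
Proof.
move=> cT iT; have /card_bijP [/= f [f' fK f'K]] := eq_card_nat cT iT.
exists (fun n => \val (f' (exist _ n (mem_set I)))),
  (fun t => \val (f (exist _ t (mem_set I)))).
split=> [n|t].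
  suff -> : exist _ (\val (f' (exist _ n (mem_set I)))) (mem_set I) =
    f' (exist _ n (mem_set I)) by rewrite f'K.
  exact: val_inj.
suff -> : exist _ (\val (f (exist _ t (mem_set I)))) (mem_set I) =
  f (exist _ t (mem_set I)) by rewrite fK.
exact: val_inj.
Qed.

(** The values lie in [option T] so that the empty set is covered as well. *)
Lemma countable_cover (T : Type) (S : set T) : countable S ->
  exists s : nat -> option T, forall t, S t -> exists n, s n = Some t.
Proof.
move=> /countable_injP [f finj].
pose P n t := S t /\ f t = n.
exists (fun n => if pselect (exists t, P n t) is left H then Some (sval (cid H))
  else None) => t St.
exists (f t); case: pselect => [H|[]]; last by exists t.
case: cid => u /= [Su fu]; congr Some; apply: finj => //; exact/mem_set.
Qed.

Section NatModels.
Variables (L : language) (sigma : sentence L) (C : structure L -> Prop).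
Hypothesis C_models : forall K, C K -> countable_model sigma K.
Hypothesis C_iso : closed_under_isomorphism C.
Hypothesis C_ext : forall K, C K ->
  exists M : structure L,
    [/\ C M, exists h : K -> M, elementary h & realizes_new_type K M].
Hypothesis C_chains : closed_under_elementary_chains C.

(** An elementary map out of a finite model is onto, so realizations of types pull back and no type
    is new. Hence every model in [C] has a copy with universe [nat]. *)
Lemma class_infinite K : C K -> ~ finite_set [set: K].
Proof.
move=> /C_ext [M [_ [h hel] [n [p [pfo [b Hb] np]]]]] fin; apply: np.
have /choice [a Ha] := fun i => elementary_finite_surj hel fin (b i).
exists a => phi pphi; apply/hel; first exact: pfo.
by have -> : h \o a = b; [exact/funext|exact: Hb].
Qed.

Lemma class_nat_copy K : C K ->
  exists x, space_of C x /\ exists h : K -> structure_of x, elementary h.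
Proof.
move=> CK; have [_ cK _] := C_models CK.
have [g [g' [gK g'K]]] := countable_infinite_enum cK (class_infinite CK).
have iso := isomorphic_sym (enum_model_iso gK g'K).
exists (enum_model g g'); split; first exact: C_iso CK iso.
have [h [he hb]] := iso.
by exists h; exact: elementary_iso.
Qed.

Lemma class_nat_extension x : space_of C x ->
  exists y, [/\ space_of C y,
    exists h : structure_of x -> structure_of y, elementary h &
    realizes_new_type (structure_of x) (structure_of y)].
Proof.
move=> /C_ext [M [CM [h hel] [n [p [pfo rM rx]]]]].
have [y [Cy [k kel]]] := class_nat_copy CM.
exists y; split=> //; first by exists (k \o h); exact: elementary_comp.
by exists n, p; split=> //; exact: realizes_elementary kel rM.
Qed.

Lemma class_nat_limit (x : nat -> model_space L)
    (e : forall n, structure_of (x n) -> structure_of (x n.+1)) :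
  (forall n, space_of C (x n)) -> (forall n, elementary (e n)) ->
  exists y (j : forall n, structure_of (x n) -> structure_of y),
    [/\ space_of C y, forall n, elementary (j n),
        forall n k, j n.+1 (e n k) = j n k &
        forall i : nat, exists n (k : structure_of (x n)), i = j n k].
Proof.
move=> Cx eel; have [M [j [jemb jS jsurj]]] := chain_union_exists eel.
have CM : C M by apply: C_chains Cx eel _; exists j.
have [_ cM _] := C_models CM.
have [g [g' [gK g'K]]] := countable_infinite_enum cM (class_infinite CM).
have iso := enum_model_iso gK g'K.
have el : elementary (g' : M -> structure_of (enum_model g g')).
  apply: elementary_iso; last by exists g.
  split=> [|f a|r a] /=; first exact: can_inj g'K.
    by congr (g' (fint M f _)); apply/funext => i /=; rewrite g'K.
  by congr (rint M r _); apply/funext => i /=; rewrite g'K.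
exists (enum_model g g'), (fun n => g' \o j n); split.
- exact: C_iso CM (isomorphic_sym iso).
- move=> n; apply: elementary_comp el.
  exact: elementary_chain_union jsurj n.
- by move=> n k /=; rewrite jS.
- move=> i; have [n [k E]] := jsurj (g i); exists n, k.
  by rewrite /= -E gK.
Qed.

End NatModels.

(** * Forcing *)

Lemma prefix_mkseq (T : eqType) (g : nat -> T) n m :
  (n <= m)%N -> prefix (mkseq g n) (mkseq g m).
Proof.
move=> nm; rewrite prefixE size_mkseq /mkseq -map_take take_iota.
by rewrite (minn_idPl nm).
Qed.

Lemma prefix_size (T : eqType) (p q : seq T) :
  prefix p q -> (size p <= size q)%N.
Proof. by move=> /prefixP [r ->]; rewrite size_cat leq_addr. Qed.

Lemma prefix_map (T U : eqType) (h : T -> U) (p q : seq T) :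
  prefix p q -> prefix (map h p) (map h q).
Proof. by move=> /prefixP [r ->]; rewrite map_cat prefix_prefix. Qed.

Lemma nth_prefix (T : eqType) (x0 : T) (p q : seq T) i :
  prefix p q -> (i < size p)%N -> nth x0 q i = nth x0 p i.
Proof. by move=> /prefixP [r ->] ip; rewrite nth_cat ip. Qed.

Lemma mkseq_of_prefix_chain (P : nat -> seq nat) (g : nat -> nat) :
  (forall n m, (n <= m)%N -> prefix (P n) (P m)) ->
  (forall k, (k < size (P k.+1))%N) ->
  (forall k, g k = nth 0%N (P k.+1) k) ->
  forall n q, prefix q (P n) -> q = mkseq g (size q).
Proof.
move=> Pmono Psize gE n q qP.
apply: (@eq_from_nth _ 0%N) => [|k kq]; first by rewrite size_mkseq.
rewrite nth_mkseq // gE -(nth_prefix 0%N qP kq).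
have kn : (k < size (P n))%N by exact: leq_trans kq (prefix_size qP).
have [le|/ltnW le] := leqP n k.+1.
  by rewrite (nth_prefix _ (Pmono _ _ le)).
by rewrite (nth_prefix _ (Pmono _ _ le)).
Qed.

(* Rasiowa-Sikorski for the poset of finite injective sequences. *)
Lemma generic_bijection (D : nat -> set (seq nat)) (p : seq nat) :
  (forall n q, uniq q -> exists q', [/\ uniq q', prefix q q' & D n q']) ->
  uniq p ->
  exists g g' : nat -> nat,
    [/\ cancel g g', cancel g' g, mkseq g (size p) = p &
        forall n, exists m, D n (mkseq g m)].
Proof.
move=> Ddense up.
(* Stage [n] first meets [D n] and then appends [n] if it is absent, which makes the limit onto. As
   [D n] may fail to be closed under extension, the prefix [q1] that meets it is recorded. *)
have /choice [F HF] : forall nq : nat * seq nat, exists q', uniq nq.2 ->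
    [/\ uniq q', prefix nq.2 q', nq.1 \in q' &
        exists q1, prefix q1 q' /\ D nq.1 q1].
  move=> [n q] /=; have [uq|] := boolP (uniq q); last by exists nil.
  have [q1 [uq1 qq1 Dq1]] := Ddense n q uq.
  have [nq1|nq1] := boolP (n \in q1).
    by exists q1 => _; split=> //; exists q1; rewrite prefix_refl.
  exists (rcons q1 n) => _; split.
  - by rewrite rcons_uniq nq1.
  - exact: prefix_trans qq1 (prefix_rcons _ _).
  - by rewrite mem_rcons mem_head.
  - by exists q1; rewrite prefix_rcons.
pose P := fix P n := if n is m.+1 then F (m, P m) else p.
have uP n : uniq (P n) by elim: n => [|n IH] //=; have [] := HF (n, P n) IH.
have HP n := HF (n, P n) (uP n).
have Pmono n m : (n <= m)%N -> prefix (P n) (P m).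
  elim: m => [|m IH]; first by rewrite leqn0 => /eqP ->; rewrite prefix_refl.
  rewrite leq_eqVlt => /orP[/eqP ->|]; first exact: prefix_refl.
  rewrite ltnS => /IH H; apply: prefix_trans H _.
  by have [] := HP m.
have inP k n : (k < n)%N -> k \in P n.
  move=> kn; have [_ _ kP _] := HP k.
  by have /prefixP [r ->] := Pmono _ _ kn; rewrite mem_cat kP.
have Psize n : (n <= size (P n))%N.
  rewrite -{1}(size_iota 0 n); apply: uniq_leq_size; first exact: iota_uniq.
  by move=> k; rewrite mem_iota => /andP[_ kn]; exact: inP.
pose g k := nth 0%N (P k.+1) k.
have gE := mkseq_of_prefix_chain Pmono (fun k => Psize k.+1)
  (fun k => erefl : g k = _).
have gP n : P n = mkseq g (size (P n)) by apply: (gE n); exact: prefix_refl.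
have ginj : injective g.
  move=> a b; pose n := (maxn a b).+1.
  have [an bn] : (a < size (P n))%N /\ (b < size (P n))%N.
    by split; apply: leq_trans (Psize n); rewrite ltnS ?leq_maxl ?leq_maxr.
  have := uP n; rewrite gP => /(uniqP 0%N) - /(_ a b).
  by rewrite !inE size_mkseq !nth_mkseq //; apply.
have /choice [g' g'K] : forall k, exists i, g i = k.
  move=> k; have := inP k k.+1 (ltnSn k).
  by rewrite gP => /mapP [i _ ->]; exists i.
exists g, g'; split=> //.
- by move=> k; apply: ginj.
- by rewrite -(gP 0%N).
- move=> n; have [_ _ _ [q1 [q1P Dq1]]] := HP n.
  by exists (size q1); rewrite -(gE n.+1).
Qed.

(** * Borel codes, the forcing relation and generic models *)

Section Forcing.
Variable L : language.
Implicit Types (x y : model_space L) (p q : seq nat).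

(** Arguments are tuples instead of functions on ordinals, so that coordinates can be pickled. *)
Definition coordinate : countType :=
  ({f : funsym L & (farity f).-tuple nat} +
   {r : relsym L & (rarity r).-tuple nat})%type.

Definition coord_val x (i : coordinate) : nat :=
  match i with
  | inl (existT f t) => x.1 f (tnth t)
  | inr (existT r t) => x.2 r (tnth t)
  end.

(** Forcing is a recursion on the way a Borel set is built, so it needs codes and not sets. *)
Inductive borel_code :=
| CEmpty
| CAtom of coordinate & nat
| CNot of borel_code
| CUnion of (nat -> borel_code).

Fixpoint denote (c : borel_code) : set (model_space L) :=
  match c with
  | CEmpty => set0
  | CAtom i m => [set x | coord_val x i = m]
  | CNot b => ~` denote b
  | CUnion bs => \bigcup_n denote (bs n)
  end.

(** The statements an enumeration must decide for the truth lemma: genericity enters only at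
    complements. *)
Fixpoint negated_subcodes (c : borel_code) : set borel_code :=
  match c with
  | CEmpty | CAtom _ _ => set0
  | CNot b => b |` negated_subcodes b
  | CUnion bs => \bigcup_n negated_subcodes (bs n)
  end.

Lemma countable_negated_subcodes c : countable (negated_subcodes c).
Proof.
elim: c => [|i m|b IH|bs IH] /=; [exact: countable0|exact: countable0| |].
  have -> : b |` negated_subcodes b = \bigcup_(i in [set: bool])
      (if i then [set b] else negated_subcodes b).
    apply/seteqP; split=> [c [->|bc]|c [[] _ /= H]].
    - by exists true.
    - by exists false.
    - by left.
    - by right.
  by apply: bigcup_countable => // -[] _; [exact: countable1|].
by apply: bigcup_countable => // n _; exact: IH.
Qed.

(* The finite sequence p is the initial segment of an enumeration g of x; the
   forced statements concern the copy of x with universe nat induced by g. *)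
Definition forces_atom x p (i : coordinate) (m : nat) : Prop :=
  match i with
  | inl (existT f t) =>
      [/\ forall k, (tnth t k < size p)%N, (m < size p)%N &
          x.1 f (fun k => nth 0%N p (tnth t k)) = nth 0%N p m]
  | inr (existT r t) =>
      (forall k, (tnth t k < size p)%N) /\
      (x.2 r (fun k => nth 0%N p (tnth t k)) : nat) = m
  end.

Definition elementary_map x y (h : nat -> nat) : Prop :=
  @elementary L (structure_of x) (structure_of y) h.

Variable P : set (model_space L).

(* Negation quantifies over elementary extensions within P as well as over
   longer sequences: this is forcing with the product of the two orders. *)
Fixpoint forces (c : borel_code) x p : Prop :=
  match c with
  | CEmpty => False
  | CAtom i m => forces_atom x p i m
  | CNot b => forall y h q, P y -> elementary_map x y h -> uniq q ->
      prefix (map h p) q -> ~ forces b y q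
  | CUnion bs => exists n, forces (bs n) x p
  end.

Lemma forces_mono c x p y h q :
  forces c x p -> P y -> elementary_map x y h -> uniq q ->
  prefix (map h p) q -> forces c y q.
Proof.
elim: c x p y h q => [|i m|b _|bs IH] x p y h q //=.
- move=> H _ /elementary_embedding [_ hf hr] _ pq.
  have sz : (size p <= size q)%N by have := prefix_size pq; rewrite size_map.
  have nq k : (k < size p)%N -> nth 0%N q k = h (nth 0%N p k).
    move=> kp; rewrite (nth_prefix 0%N pq) ?size_map //.
    by rewrite (nth_map 0%N).
  case: i H => [[f t]|[r t]] /= [].
    move=> tp mp E; split; [|exact: leq_trans mp sz|].
      by move=> k; exact: leq_trans (tp k) sz.
    rewrite nq // -E [RHS]hf /=; congr (y.1 f _).
    by apply/funext => k /=; rewrite nq.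
  move=> tp <-; split; first by move=> k; exact: leq_trans (tp k) sz.
  rewrite [x.2 r _ in RHS]hr /=; congr (nat_of_bool (y.2 r _)).
  by apply/funext => k /=; rewrite nq.
- move=> H Py hel uq pq z k r Pz kel ur qr; apply: (H z (k \o h)) => //.
    exact: elementary_comp hel kel.
  by rewrite map_comp; apply: prefix_trans qr; exact: prefix_map.
- by move=> [n Hn] Py hel uq pq; exists n; exact: IH Hn Py hel uq pq.
Qed.

Lemma forces_prefix c x p q :
  P x -> uniq q -> prefix p q -> forces c x p -> forces c x q.
Proof.
move=> Px uq pq H; apply: (forces_mono (h := id) H) => //.
by rewrite map_id.
Qed.

Lemma forces_elementary c x p y h :
  P y -> elementary_map x y h -> uniq p -> forces c x p ->
  forces c y (map h p).
Proof.
move=> Py hel up H; apply: (forces_mono H Py hel); last exact: prefix_refl.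
by rewrite map_inj_uniq //; have [] := elementary_embedding hel.
Qed.

Lemma forces_not_consistent c x p q :
  P x -> uniq q -> prefix p q -> forces (CNot c) x p -> ~ forces c x q.
Proof.
move=> Px uq pq H; apply: (H x id) => //.
by rewrite map_id.
Qed.

(** The second alternative lengthens the sequence but keeps the model. Thus, although
    [forces (CNot c)] looks at all extensions of [x], meeting dense sets of sequences over [x] alone
    decides [c]. *)
Definition decidable_at c x p : Prop :=
  forces (CNot c) x p \/
  exists q, [/\ uniq q, prefix p q & forces c x q].

Definition generic_model (S : set borel_code) x : Prop :=
  forall c p, S c -> uniq p -> decidable_at c x p.

Lemma decidable_at_elementary c x p y h :
  P y -> elementary_map x y h -> uniq p -> decidable_at c x p ->
  decidable_at c y (map h p).
Proof.
move=> Py hel up [H|[q [uq pq H]]].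
  by left; exact: forces_elementary H.
right; exists (map h q); split; last exact: forces_elementary H.
  by rewrite map_inj_uniq //; have [] := elementary_embedding hel.
exact: prefix_map.
Qed.

(** Induction on [c]. At a complement, the decision about [b] gives one direction; for the other,
    initial segments forcing [b] and [CNot b] would have a common extension at length [maxn m n]. *)
Lemma truth_lemma c x (g g' : nat -> nat) :
  P x -> cancel g g' -> cancel g' g ->
  (forall b, negated_subcodes c b -> exists m,
     forces b x (mkseq g m) \/ forces (CNot b) x (mkseq g m)) ->
  denote c (@enum_model L (structure_of x) g g') <->
  exists m, forces c x (mkseq g m).
Proof.
move=> Px gK g'K.
have ug m : uniq (mkseq g m) by apply/mkseq_uniq; exact: can_inj gK.
have bound r (t : r.-tuple nat) : exists n, forall k, (tnth t k < n)%N.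
  exists (\max_k tnth t k).+1 => k; rewrite ltnS.
  exact: (leq_bigmax (F := fun k => tnth t k)).
elim: c => [|i m|b IH|bs IH] /= dec.
- by split=> // -[].
- case: i => [[f t]|[r t]] /=; split.
  + move=> E; have [n tn] := bound _ t; exists (maxn n m.+1).
    have lt k : (tnth t k < maxn n m.+1)%N.
      by apply: leq_trans (tn k) _; exact: leq_maxl.
    split=> [k||]; rewrite ?size_mkseq ?leq_maxr //.
    rewrite nth_mkseq ?leq_maxr //.
    have -> : g m = x.1 f (g \o tnth t) by rewrite -E g'K.
    congr (x.1 f _).
    by apply/funext => k; rewrite nth_mkseq.
  + move=> [n [tn mn]]; rewrite size_mkseq in tn mn.
    rewrite nth_mkseq // => E; apply: (can_inj gK).
    rewrite g'K -E; congr (x.1 f _).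
    by apply/funext => k; rewrite /= nth_mkseq.
  + move=> E; have [n tn] := bound _ t; exists n.
    split=> [k|]; rewrite ?size_mkseq //.
    rewrite -E; congr (nat_of_bool (x.2 r _)).
    by apply/funext => k; rewrite nth_mkseq.
  + move=> [n [tn]] <-; rewrite size_mkseq in tn.
    congr (nat_of_bool (x.2 r _)).
    by apply/funext => k; rewrite /= nth_mkseq.
- have {}IH := IH (fun c H => dec c (or_intror H)); split.
    move=> nb; have [m [Hm|Hm]] := dec b (or_introl erefl); last by exists m.
    by exfalso; apply: nb; apply/IH; exists m.
  move=> [m Hm] /IH [n Hn].
  apply: (forces_not_consistent Px (ug (maxn m n)) (prefix_mkseq _ _) Hm).
    exact: leq_maxl.
  apply: forces_prefix Hn => //; apply: prefix_mkseq; exact: leq_maxr.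
- have {}IH n := IH n (fun c H => dec c (ex_intro2 _ _ n I H)); split.
    by move=> [n _ /IH [m Hm]]; exists m, n.
  by move=> [m [n H]]; exists n => //; apply/IH; exists m.
Qed.

Hypothesis limit_closed : forall (xs : nat -> model_space L)
    (e : forall n, structure_of (xs n) -> structure_of (xs n.+1)),
  (forall n, P (xs n)) -> (forall n, elementary (e n)) ->
  exists y (j : forall n, structure_of (xs n) -> structure_of y),
    [/\ P y, forall n, elementary (j n),
        forall n k, j n.+1 (e n k) = j n k &
        forall i : nat, exists n (k : structure_of (xs n)), i = j n k].

(** Dependent choice followed by a limit. The state carries the composite map [k] from [x0], so that
    step [n] can treat a sequence of elements of [x0] inside the current model. *)
Lemma chain_of_extensions x0
    (Q : nat -> model_space L -> (nat -> nat) -> model_space L ->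
         (nat -> nat) -> Prop) :
  P x0 ->
  (forall n x k, P x -> elementary_map x0 x k ->
     exists y h, [/\ P y, elementary_map x y h & Q n x k y h]) ->
  exists (xs : nat -> model_space L) (es ks js : nat -> nat -> nat) y,
    [/\ xs 0%N = x0,
        forall n, P (xs n),
        P y /\ forall n, elementary_map (xs n) y (js n),
        forall n, [/\ Q n (xs n) (ks n) (xs n.+1) (es n),
                      js n.+1 \o es n = js n & js n \o ks n = js 0%N] &
        forall i, exists n k, i = js n k].
Proof.
move=> Px0 step.
pose st := (model_space L * (nat -> nat))%type.
pose ok (s : st) := P s.1 /\ elementary_map x0 s.1 s.2.
have /choice [F HF] : forall ns : nat * st, exists s' : st, ok ns.2 ->
    [/\ P s'.1, elementary_map ns.2.1 s'.1 s'.2 &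
        Q ns.1 ns.2.1 ns.2.2 s'.1 s'.2].
  move=> [n s]; have [[Ps sel]|nok] := pselect (ok s); last by exists s.
  by have [y [h H]] := step n s.1 s.2 Ps sel; exists (y, h).
pose s := fix s n : st := if n is m.+1 then
  let s' := F (m, s m) in (s'.1, s'.2 \o (s m).2) else (x0, id).
pose xs n := (s n).1; pose ks n := (s n).2; pose es n := (F (n, s n)).2.
have okS n : ok (s n).
  elim: n => [|n IH]; first by split=> //; exact: elementary_map_id.
  have [PF Fel _] := HF (n, s n) IH; split=> //=.
  by case: IH => _ IH; exact: elementary_comp IH Fel.
have Pxs n : P (xs n) by case: (okS n).
have Hes n : elementary_map (xs n) (xs n.+1) (es n).
  by have [] := HF (n, s n) (okS n).
have [y [j [Py jel jS jsurj]]] := limit_closed Pxs Hes.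
exists xs, es, ks, j, y; split=> // n.
have jES m : j m.+1 \o es m = j m by apply/funext => k /=; rewrite jS.
split; [by have [] := HF (n, s n) (okS n)|exact: jES|].
elim: n => [|n IH]; first by apply/funext.
rewrite -[RHS]IH -[j n in RHS]jES; exact: compA.
Qed.

(** A failure of [forces (CNot c) x p] is itself an extension [y] with a sequence [q] forcing
    [c]. *)
Lemma decide_extension c x p : P x -> uniq p ->
  exists y h, [/\ P y, elementary_map x y h & decidable_at c y (map h p)].
Proof.
move=> Px up; have [H|] := pselect (forces (CNot c) x p).
  exists x, id; split=> //.
  by left; rewrite map_id.
move=> /existsNP [y /existsNP [h /existsNP [q /not_implyP [Py]]]].
move=> /not_implyP [hel /not_implyP [uq /not_implyP [pq /contrapT H]]].
by exists y, h; split=> //; right; exists q.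
Qed.

(** Step [n] treats the pair of a sequence over [x] and an index of a code that [n] encodes;
    decisions persist to the limit by [decidable_at_elementary]. *)
Lemma decide_all_extension (S : set borel_code) x : countable S -> P x ->
  exists y h, [/\ P y, elementary_map x y h &
    forall c p, S c -> uniq p -> decidable_at c y (map h p)].
Proof.
move=> /countable_cover [s Hs] Px.
pose Q n (_ : model_space L) (k : nat -> nat) y h := forall p i c, uniq p ->
  unpickle n = Some (p, i) -> s i = Some c ->
  decidable_at c y (map (h \o k) p).
have [|xs [es [ks [js [y [xs0 Pxs [Py jel] HQ _]]]]]] :=
  @chain_of_extensions x Q Px.
  move=> n z k Pz kel.
  have idz : exists y h, [/\ P y, elementary_map z y h &
      forall p i c, uniq p -> None = Some (p, i) -> s i = Some c ->
        decidable_at c y (map (h \o k) p)].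
    by exists z, id.
  rewrite /Q; case: (@unpickle (seq nat * nat)%type n) => [[p i]|] //.
  have [up|nup] := boolP (uniq p); last first.
    exists z, id; split=> //.
    by move=> p' i' c up' [E _]; rewrite E up' in nup.
  case E : (s i) => [c|]; last first.
    exists z, id; split=> //.
    by move=> p' i' c up' [_ <-]; rewrite E.
  have [|y [h [Py hel H]]] := decide_extension c Pz (p := map k p).
    by rewrite map_inj_uniq //; have [] := elementary_embedding kel.
  exists y, h; split=> // p' i' c' _ [<- <-]; rewrite E => -[<-].
  by rewrite map_comp.
exists y, (js 0%N); split=> //; first by have := jel 0%N; rewrite xs0.
move=> c p Sc up; have [i si] := Hs c Sc.
have [Qn jes jks] := HQ (pickle (p, i)).
have E : js 0%N = js (pickle (p, i)).+1 \o (es (pickle (p, i)) \o ks (pickle (p, i))).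
  by rewrite -jks -jes.
rewrite E map_comp; apply: (decidable_at_elementary Py (jel _)).
  apply: (@map_uniq _ _ (js (pickle (p, i)).+1)); rewrite -map_comp -E.
  by rewrite map_inj_uniq //; have [] := elementary_embedding (jel 0%N).
exact: Qn up (pickleK _) si.
Qed.

(** One round decides only sequences coming from the old model, so rounds are iterated: a finite
    sequence of the limit already lives at some stage [n] and is decided at stage [n.+1]. *)
Lemma generic_extension (S : set borel_code) x : countable S -> P x ->
  exists y h, [/\ P y, elementary_map x y h & generic_model S y].
Proof.
move=> cS Px.
pose Q (n : nat) (_ : model_space L) (k : nat -> nat) y h :=
  forall c p, S c -> uniq p -> decidable_at c y (map h p).
have [n z k Pz _|xs [es [ks [js [y [xs0 Pxs [Py jel] HQ jsurj]]]]]] :=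
  @chain_of_extensions x Q Px; first exact: decide_all_extension.
exists y, (js 0%N); split=> //; first by have := jel 0%N; rewrite xs0.
move=> c p Sc up.
have [n [b E]] : exists n (b : 'I_(size p) -> nat),
    (fun i : 'I_(size p) => nth 0%N p i) = js n \o b.
  apply: (chain_common_level (A := fun=> nat)) => [n m|i]; last exact: jsurj.
  elim: m => [|m IH]; first by rewrite leqn0 => /eqP -> k; exists k.
  rewrite leq_eqVlt => /orP[/eqP ->|]; first by move=> k; exists k.
  rewrite ltnS => /IH {}IH k; have [l <-] := IH k.
  by exists (es m l); have [_ <- _] := HQ m.
have pE : p = map (js n) (map b (enum 'I_(size p))).
  rewrite -map_comp -E map_comp val_enum_ord -/(mkseq _ _).
  by rewrite mkseq_nth.
move: (map b _) pE up => p' -> up; have up' := map_uniq up.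
have [Qn <- _] := HQ n; rewrite map_comp.
apply: (decidable_at_elementary Py (jel _)) (Qn _ _ Sc up').
apply: (@map_uniq _ _ (js n.+1)); rewrite -map_comp.
by have [_ -> _] := HQ n.
Qed.

End Forcing.

(** * Borel sets of models *)

Lemma cvg_prod_topology (I : Type) (T : I -> topologicalType)
    (u : nat -> prod_topology T) (l : prod_topology T) :
  (forall i, u n i @[n --> \oo] --> l i) -> u @ \oo --> l.
Proof.
move=> ul; apply/cvg_sup => i A [_ [[B Bop <-] Bl BA]].
apply: filterS BA _; apply: (ul i); exact: open_nbhs_nbhs.
Qed.

Section Codes.
Variable L : language.
Implicit Types x y : model_space L.

Lemma coord_val_fun x f (a : 'I_(farity f) -> nat) :
  coord_val x (inl (existT _ f [tuple of [seq a k | k <- ord_tuple _]])) =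
  x.1 f a.
Proof. by congr (x.1 f _); apply/funext => k; rewrite tnth_map tnth_ord_tuple. Qed.

Lemma coord_val_rel x r (a : 'I_(rarity r) -> nat) :
  coord_val x (inr (existT _ r [tuple of [seq a k | k <- ord_tuple _]])) =
  x.2 r a.
Proof.
congr (nat_of_bool (x.2 r _)); apply/funext => k.
by rewrite tnth_map tnth_ord_tuple.
Qed.

Lemma cvg_model_space (u : nat -> model_space L) x :
  (forall i, \forall n \near \oo, coord_val (u n) i = coord_val x i) ->
  u @ \oo --> x.
Proof.
move=> ux.
have cvg1 : (fun n => (u n).1) @ \oo --> x.1.
  apply: cvg_prod_topology => f; apply: cvg_prod_topology => a.
  apply: cvg_near_cst.
  have := ux (inl (existT _ f [tuple of [seq a k | k <- ord_tuple _]])).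
  by apply: filterS => n; rewrite !coord_val_fun.
have cvg2 : (fun n => (u n).2) @ \oo --> x.2.
  apply: cvg_prod_topology => r; apply: cvg_prod_topology => a.
  apply: cvg_near_cst.
  have := ux (inr (existT _ r [tuple of [seq a k | k <- ord_tuple _]])).
  by apply: filterS => n; rewrite !coord_val_rel => /(can_inj oddb).
move=> A [[B1 B2] /= [/cvg1 nB1 /cvg2 nB2] sub].
have nB : \forall n \near \oo, B1 (u n).1 /\ B2 (u n).2 by exact: filterI.
apply: filterS nB => n [B1n B2n].
by rewrite /= [u n]surjective_pairing; exact: sub.
Qed.

(** Otherwise points outside [O] agreeing with [x] on ever more coordinates would converge to
    [x]. *)
Lemma open_agree (O : set (model_space L)) x : open O -> O x ->
  exists n, forall y,
    (forall i, (pickle i < n)%N -> coord_val y i = coord_val x i) -> O y.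
Proof.
move=> Oop Ox; apply: contrapT => nex.
have /choice [u Hu] : forall n, exists y,
    (forall i, (pickle i < n)%N -> coord_val y i = coord_val x i) /\ ~ O y.
  move=> n; apply: contrapT => ny; apply: nex; exists n => y Hy.
  by apply: contrapT => nO; apply: ny; exists y.
have : u @ \oo --> x.
  apply: cvg_model_space => i; exists (pickle i).+1 => // n /= le.
  by have [-> //] := Hu n.
move=> /(_ O (open_nbhs_nbhs (conj Oop Ox))) [n _ Hn].
by have [_] := Hu n; apply; apply: Hn => /=.
Qed.

Definition coded (A : set (model_space L)) : Prop := exists c, denote c = A.

Lemma coded0 : coded set0. Proof. by exists (CEmpty L). Qed.

Lemma codedC A : coded A -> coded (~` A).
Proof. by move=> [c <-]; exists (CNot c). Qed.

Lemma coded_bigcup (A : nat -> set (model_space L)) :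
  (forall n, coded (A n)) -> coded (\bigcup_n A n).
Proof.
move=> /choice [c Hc]; exists (CUnion c) => /=.
by apply: eq_bigcupr => n _; exact: Hc.
Qed.

Lemma coded_bigcap (A : nat -> set (model_space L)) :
  (forall n, coded (A n)) -> coded (\bigcap_n A n).
Proof.
move=> cA; rewrite -[X in coded X]setCK setC_bigcap; apply: codedC.
by apply: coded_bigcup => n; exact: codedC.
Qed.

Lemma coded_cylinder n (s : seq nat) :
  coded [set x | forall i : coordinate L, (pickle i < n)%N ->
           coord_val x i = nth 0%N s (pickle i)].
Proof.
have -> : [set x | forall i : coordinate L, (pickle i < n)%N ->
    coord_val x i = nth 0%N s (pickle i)] =
  \bigcap_k [set x | forall i : coordinate L, pickle i = k -> (k < n)%N ->
    coord_val x i = nth 0%N s (pickle i)].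
  apply/seteqP; split=> [x H k _ i <-|x H i lt]; first exact: H.
  exact: (H (pickle i)).
apply: coded_bigcap => k.
have [[i [ik kn]]|no] := pselect (exists i : coordinate L, pickle i = k /\ (k < n)%N).
  exists (CAtom i (nth 0%N s (pickle i))); apply/seteqP; split=> x /=.
    by move=> E j; rewrite -ik => /(pcan_inj pickleK) ->.
  by apply.
suff -> : [set x | forall i : coordinate L, pickle i = k -> (k < n)%N ->
    coord_val x i = nth 0%N s (pickle i)] = ~` set0.
  by apply: codedC; exact: coded0.
rewrite setC0; apply/seteqP; split=> // x _ i ik kn.
by exfalso; apply: no; exists i.
Qed.

Lemma coded_open (O : set (model_space L)) : open O -> coded O.
Proof.
move=> Oop.
pose cyl n s := [set x | forall i : coordinate L, (pickle i < n)%N ->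
  coord_val x i = nth 0%N s (pickle i)].
pose A m := if @unpickle (nat * seq nat)%type m is Some (n, s) then
  if `[< cyl n s `<=` O >] then cyl n s else set0 else set0.
have -> : O = \bigcup_m A m.
  apply/seteqP; split=> [x Ox|x [m _]]; last first.
    rewrite /A; case: unpickle => [[n s]|] //.
    by case: asboolP => [sub /sub|].
  have [n Hn] := open_agree Oop Ox.
  (* The entry [0] at numbers that encode no coordinate is never consulted by [cyl]. *)
  pose s := mkseq (fun k => if @pickle_inv (coordinate L) k is Some i
    then coord_val x i else 0%N) n.
  have sE (i : coordinate L) : (pickle i < n)%N ->
      nth 0%N s (pickle i) = coord_val x i.
    by move=> lt; rewrite nth_mkseq // pickleK_inv.
  exists (pickle (n, s)) => //; rewrite /A pickleK.
  case: asboolP => [_ i /sE //|[]] y Hy.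
  by apply: Hn => i lt; rewrite -sE //; exact: Hy.
apply: coded_bigcup => m; rewrite /A.
case: unpickle => [[n s]|]; last exact: coded0.
by case: asboolP => _; [exact: coded_cylinder|exact: coded0].
Qed.

(** Traces on [X] of coded sets form a sigma-algebra, and the open sets of the subspace are traces
    of open sets, which are coded. *)
Lemma borel_coded (X : set (model_space L)) (A : set X) :
  borel A -> exists c, A = [set z | denote c (\val z)].
Proof.
pose G : set (set X) := [set A | exists c, A = [set z | denote c (\val z)]].
suff : <<s @open X >> `<=` G by apply.
apply: smallest_sub; last first.
  by move=> _ [V /coded_open [c <-] <-]; exists c; rewrite set_valE.
split.
- by exists (CEmpty L).
- by move=> _ [c ->]; exists (CNot c); rewrite setTD.
- move=> B /choice [c Hc]; exists (CUnion c).
  apply/seteqP; split=> z [n _ Hn]; exists n => //.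
    by have := Hn; rewrite Hc.
  by rewrite Hc.
Qed.

End Codes.

(** * Countable separating families in Polish spaces *)

Lemma polish_separating_opens (R : realType) (Y : completePseudoMetricType R) :
  polish Y -> exists2 U : set (set Y), countable U &
    U `<=` open /\
    forall y z, (forall A, U A -> A y -> A z) -> y = z.
Proof.
move=> [hY [D cD dD]].
exists ((fun dk => (ball dk.1 (dk.2.+1%:R^-1 : R)%R)°) @` (D `*` [set: nat])).
  apply: sub_countable (card_image_le _ _) _.
  exact: countableX.
split=> [_ [[d k] _ <-]|y z sep]; first exact: open_interior.
apply: hY => A B /nbhs_ballP [e /= e0 eA] nB.
exists z; split; last exact: nbhs_singleton.
(* With [r < e / 2] and a centre [d] within [r / 2] of [y], the ball of radius [r] about [d] has [y]
   in its interior and lies within [3r / 2 < e] of [y]. *)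
have [k] := ltr_add_invr (divr_gt0 e0 (ltr0n _ 2)).
rewrite add0r; set r := (k.+1%:R^-1 : R)%R => re.
have r0 : (0 < r)%R by rewrite invr_gt0.
have r20 : (0 < r / 2)%R by rewrite divr_gt0.
have [||d [dy Dd]] := dD (ball y (r / 2)%R)°.
- by exists y; exact: nbhsx_ballx.
- exact: open_interior.
have {}dy := interior_subset dy.
have : (ball d r)° z.
  apply: sep; first by exists (d, k).
  apply/nbhs_ballP; exists (r / 2)%R => // w wy.
  by apply: ball_split wy; exact: ball_sym.
move=> /interior_subset dz; apply: eA.
apply: le_ball (ball_triangle dy dz).
lra.
Qed.

(** * Forcing the value of a Borel reduction *)

Theorem theorem4p3 (R : realType) (L : language) (sigma : sentence L)
    (C : structure L -> Prop)
    (C_models : forall K, C K -> countable_model sigma K)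
    (C_iso : closed_under_isomorphism C)
    (C_nonempty : exists K, C K)
    (C_ext : forall K, C K ->
       exists M : structure L,
         [/\ C M, exists h : K -> M, elementary h & realizes_new_type K M])
    (C_chains : closed_under_elementary_chains C) :
  ~ essentially_countable R (@iso_on L C).
Proof.
move=> [Y [F [polY [_ _ cF] [[f [fborel fred]] _]]]].
pose P := space_of C.
have limit_closed := class_nat_limit C_models C_iso C_ext C_chains.
have [U cU [Uopen Usep]] := polish_separating_opens polY.
have /choice [B HB] : forall A, exists c,
    U A -> f @^-1` A = [set z : P | denote c (\val z)].
  move=> A; have [UA|] := pselect (U A); last by exists (CEmpty L).
  have /borel_coded [c Hc] : borel (f @^-1` A).
    by apply: fborel; apply: sub_gen_smallest; exact: Uopen.
  by exists c.
(* The double complement puts both [CNot (B A)] and [B A] into [S]. It is needed because excluding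
   that an extension forces [CNot (B A)] yields only that [CNot (CNot (B A))] is forced. *)
pose S := \bigcup_(A in U) negated_subcodes (CNot (CNot (B A))).
have cS : countable S.
  by apply: bigcup_countable => // A _; exact: countable_negated_subcodes.
have [t St] := countable_cover cS.
have decide x q n : P x -> generic_model P S x -> uniq q -> exists q',
    [/\ uniq q', prefix q q' & forall c, S c -> t n = Some c ->
       forces P c x q' \/ forces P (CNot c) x q'].
  move=> Px gx uq; case E : (t n) => [c|]; last first.
    by exists q; rewrite prefix_refl.
  have [Sc|nSc] := pselect (S c); last first.
    by exists q; rewrite prefix_refl; split=> // c' Sc' [E']; rewrite E' in nSc.
  have [H|[q' [uq' qq' H]]] := gx c q Sc uq.
    by exists q; rewrite prefix_refl; split=> // c' _ [<-]; right.
  by exists q'; split=> // c' _ [<-]; left.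
have truth x (g g' : nat -> nat) : P x -> cancel g g' -> cancel g' g ->
    (forall n, exists m, forall c, S c -> t n = Some c ->
       forces P c x (mkseq g m) \/ forces P (CNot c) x (mkseq g m)) ->
    exists z : P, [/\ isomorphic (structure_of (\val z)) (structure_of x),
      forall A m, U A -> forces P (CNot (B A)) x (mkseq g m) -> ~ A (f z) &
      forall A m, U A -> forces P (CNot (CNot (B A))) x (mkseq g m) ->
        A (f z)].
  move=> Px gK g'K dec.
  have iso := @enum_model_iso L (structure_of x) g g' gK g'K.
  have Pz : P (@enum_model L (structure_of x) g g').
    exact: C_iso Px (isomorphic_sym iso).
  pose z : P := exist (fun w => w \in P) _ (mem_set Pz).
  have decS c : S c -> exists m,
      forces P c x (mkseq g m) \/ forces P (CNot c) x (mkseq g m).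
    by move=> Sc; have [n tn] := St c Sc; have [m Hm] := dec n; exists m; exact: Hm.
  have fzE A : U A -> A (f z) <-> denote (B A) (\val z).
    by move=> UA; have := HB A UA => /(congr1 (@^~ z)) /= ->.
  exists z; split=> // A m UA H.
    move=> /fzE - /(_ UA) dz.
    have [_] := truth_lemma (c := CNot (B A)) Px gK g'K
      (fun b Hb => decS b (ex_intro2 _ _ A UA (or_intror Hb))).
    by apply; first by exists m.
  apply/fzE => //; apply: contrapT => nd.
  have [_] := truth_lemma (c := CNot (CNot (B A))) Px gK g'K
    (fun b Hb => decS b (ex_intro2 _ _ A UA Hb)).
  by apply; first by exists m.
have [K0 CK0] := C_nonempty.
have [x0 [Px0 _]] := class_nat_copy C_models C_iso C_ext CK0.
have [x [_ [Px _ gx]]] := generic_extension limit_closed cS Px0.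
pose zx : P := exist (fun w => w \in P) x (mem_set Px).
have [e He] := countable_cover (cF (f zx)).
(* Here [q] forces the value of [f] out of a neighbourhood of [y], the [i]-th listed member of the
   class of [f zx]. *)
pose avoid i q := forall y, F (f zx) y -> e i = Some y ->
  exists A, [/\ U A, A y & forces P (CNot (B A)) x q].
have [dense|] := pselect (forall i q, uniq q -> exists q',
    [/\ uniq q', prefix q q' & avoid i q']).
  (* Odd requirements avoid the members of the class, even ones decide the codes in [S]. The
     resulting copy [z] of [x] has [f z] in the class, yet different from every listed member. *)
  pose D n q := if odd n then avoid n./2 q else forall c, S c ->
    t n./2 = Some c -> forces P c x q \/ forces P (CNot c) x q.
  have Ddense n q : uniq q -> exists q', [/\ uniq q', prefix q q' & D n q'].
    by rewrite /D; case: odd => uq; [exact: dense|exact: decide].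
  have [g [g' [gK g'K _ Dg]]] := @generic_bijection D [::] Ddense isT.
  have [n|z [iso znot _]] := truth x g g' Px gK g'K.
    by have [m] := Dg n.*2; rewrite /D odd_double doubleK; exists m.
  have Fz : F (f zx) (f z).
    by apply/fred; exact: isomorphic_sym.
  have [i ei] := He _ Fz.
  have [m] := Dg i.*2.+1; rewrite /D /= odd_double uphalf_double.
  by move=> /(_ _ Fz ei) [A [UA Afz /(znot A m UA)]].
move=> /existsNP [i /existsNP [p /not_implyP [up Hp]]].
(* Without such a [y], [avoid i] would hold vacuously at [p]. *)
have [y [Fy ei]] : exists y, F (f zx) y /\ e i = Some y.
  apply: contrapT => no; apply: Hp; exists p; rewrite prefix_refl.
  by split=> // y Fy ei; exfalso; apply: no; exists y.
(* Genericity of [x] for [CNot (B A)] leaves only this: an extension of [p] forcing [CNot (B A)]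
   would avoid [y]. *)
have pforces A : U A -> A y -> forces P (CNot (CNot (B A))) x p.
  move=> UA Ay; have [//|[q [uq pq H]]] : decidable_at P (CNot (B A)) x p.
    by apply: gx => //; exists A => //; left.
  exfalso; apply: Hp; exists q; split=> // y' Fy'; rewrite ei => -[<-].
  by exists A.
have [x1 [Px1 [h1 h1el] [n [tp [tpfo x1tp nxtp]]]]] :=
  class_nat_extension C_models C_iso C_ext Px.
have [x2 [h2 [Px2 h2el gx2]]] := generic_extension limit_closed cS Px1.
have hel : elementary_map x x2 (h2 \o h1) by exact: elementary_comp h1el h2el.
have up2 : uniq (map (h2 \o h1) p).
  by rewrite map_inj_uniq //; have [] := elementary_embedding hel.
have [g [g' [gK g'K gp Dg]]] := generic_bijection
  (fun n q => decide x2 q n Px2 gx2) up2.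
have [z [iso _ zin]] := truth x2 g g' Px2 gK g'K Dg.
(* The enumeration [g] starts with the image of [p], which still forces the double complements over
   [x2]; so [f z] lies in every member of [U] containing [y]. *)
have fz : y = f z.
  apply: Usep => A UA Ay; apply: (zin A (size (map (h2 \o h1) p)) UA).
  rewrite gp; exact: forces_elementary (pforces A UA Ay).
have isox : isomorphic (structure_of x) (structure_of (\val z)).
  by apply/(fred zx z); rewrite -fz.
have [k [ke kb]] := isomorphic_sym (isomorphic_trans isox iso).
apply: nxtp; apply: (realizes_elementary tpfo (elementary_iso ke kb)).
exact: realizes_elementary tpfo h2el x1tp.
Qed.
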